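(* Let $\Gamma$ be a finite bidirected graph with a source $q$ having no entering edges and edge capacities $c\colon E\Gamma\to\mathbb{Z}_+$. For a maximum integer bidirected $q$-flow $g$, let $\vec R_g$ (resp. $\overleftarrow R_g$) be the set of nodes $v$ reachable by a $c_g$-simple walk in the residual graph $\Gamma_g$ that starts at $q$ leaving $q$ and ends at $v$ entering $v$ (resp. leaving $v$). Let $A_g=(\vec R_g-\overleftarrow R_g)\cup(\overleftarrow R_g-\vec R_g)$, $M_g=V\Gamma-(\vec R_g\cup\overleftarrow R_g)$, let $B^g_1,\dots,B^g_k$ be the node sets of connected components of the underlying undirected graph of the subgraph of $\Gamma_g$ induced by $\vec R_g\cap\overleftarrow R_g$, and let $\Gamma'_g$ be obtained from $\Gamma$ by flipping the set $\overleftarrow R_g-\vec R_g$. Then the sets $\overleftarrow R_g$ are the same for all maximum integer bidirected $q$-flows $g$, and likewise the sets $\vec R_g$, the tuples $(\Gamma'_g\mid A_g,M_g;B^g_1,\dots,B^g_k)$ (up to the order of the $B$'s), and the graphs $\Gamma'_g$.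
   Context: In a bidirected graph each edge has at each end a direction (entering or leaving that end); loops leaving twice or entering twice are allowed. A walk is a sequence $v_0,e_1,v_1,\dots,e_k,v_k$ where $e_i$ joins $v_{i-1},v_i$ and for $0<i<k$ one of $e_i,e_{i+1}$ enters and the other leaves $v_i$. For $f\ge0$ on edges, $\mathrm{div}_f(v)=f(\delta^{out}(v))-f(\delta^{in}(v))$ with loops counted twice. An integer bidirected $q$-flow is $g\colon E\Gamma\to\mathbb{Z}_+$ with $\mathrm{div}_g(v)=0$ for all $v\ne q$; its value is $\mathrm{div}_g(q)$; it is feasible if $g\le c$; maximum means feasible of maximum value. Residual graph $\Gamma_g$: node set $V\Gamma$; each $e$ with $g(e)<c(e)$ with residual capacity $c_g(e)=c(e)-g(e)$, and for each $e$ with $g(e)>0$ a reverse edge $e^R$ with both end-directions reversed and $c_g(e^R)=g(e)$. A walk is $c_g$-simple if it traverses each edge $e$ at most $c_g(e)$ times. Flipping a set $X\subseteq V\Gamma-\{q\}$ reverses the direction of every edge at each of its ends lying in $X$. *)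

(* Defs.v *)
From mathcomp Require Import all_boot all_order all_algebra.
From mathcomp Require Import boolp.

Set Implicit Arguments.
Unset Strict Implicit.
Unset Printing Implicit Defensive.

Import GRing.Theory Num.Theory.

Local Open Scope ring_scope.

(* The two ends of the edge [e] are the pairs [(e, false)] and [(e, true)].
   [tip] gives the node at an end; [leaves] is true if the edge leaves that
   node at this end, and false if it enters it.  Parallel edges and all loops
   are allowed.  Finite functions make [=] on bidirected graphs extensional. *)
Record bigraph (V E : finType) := Bigraph {
  tip : {ffun E * bool -> V};
  leaves : {ffun E * bool -> bool}
}.

Definition opp_end (E : finType) (h : E * bool) : E * bool := (h.1, ~~ h.2).

Section Walks.

Variables (V E : finType) (G : bigraph V E).

(* A walk is the sequence of the ends through which its edges are taken:
   [h] stands for the traversal of [h.1] from the end [h] to [opp_end h].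
   At an intermediate node the two meeting ends have opposite directions. *)
Definition follow (h h' : E * bool) : bool :=
  (tip G (opp_end h) == tip G h') && (leaves G (opp_end h) != leaves G h').

Definition walk (u v : V) (s : seq (E * bool)) : bool :=
  if s is h :: s' then
    [&& tip G h == u, path follow h s' & tip G (opp_end (last h s')) == v]
  else u == v.

Definition cap_simple (cap : E -> nat) (s : seq (E * bool)) : Prop :=
  forall e : E, (count (fun h : E * bool => h.1 == e) s <= cap e)%N.

(* Nodes [v] to which a simple walk with at least one edge leads that leaves
   [q] and, at its last end, leaves [v] (if [d]) or enters [v] (if [~~ d]). *)
Definition reach (cap : E -> nat) (q : V) (d : bool) : {set V} :=
  [set v | `[< exists (h : E * bool) (s : seq (E * bool)),
     [/\ walk q v (h :: s), cap_simple cap (h :: s),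
         leaves G h & leaves G (opp_end (last h s)) = d] >]].

Definition adj_in (X : {set V}) : rel V := fun u v =>
  [&& u \in X, v \in X &
      [exists h : E * bool, (tip G h == u) && (tip G (opp_end h) == v)]].

Definition components (X : {set V}) : {set {set V}} :=
  equivalence_partition (connect (adj_in X)) X.

Definition flip (X : {set V}) : bigraph V E :=
  Bigraph (tip G) [ffun h => leaves G h (+) (tip G h \in X)].

End Walks.

Section Flows.

Variables (V E : finType) (G : bigraph V E) (q : V) (c : E -> nat).

Definition no_entering : Prop := forall h : E * bool, tip G h = q -> leaves G h.

(* The sums range over ends, so that loops are counted twice. *)
Definition divergence (f : E -> nat) (v : V) : int :=
  \sum_(h : E * bool | (tip G h == v) && leaves G h) (f h.1)%:Z -
  \sum_(h : E * bool | (tip G h == v) && ~~ leaves G h) (f h.1)%:Z.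

Definition qflow (g : E -> nat) : Prop :=
  forall v : V, v != q -> divergence g v = 0.

Definition feasible (g : E -> nat) : Prop := forall e : E, (g e <= c e)%N.

Definition maximum_qflow (g : E -> nat) : Prop :=
  [/\ qflow g, feasible g &
      forall g' : E -> nat,
        qflow g' -> feasible g' -> divergence g' q <= divergence g q].

(* [(e, false)] is the edge [e] itself, [(e, true)] its reverse. *)
Definition rescap (g : E -> nat) (x : E * bool) : nat :=
  if x.2 then g x.1 else (c x.1 - g x.1)%N.

Definition resedge (g : E -> nat) : finType :=
  {x : E * bool | (0 < rescap g x)%N}.

Definition residual (g : E -> nat) : bigraph V (resedge g) :=
  Bigraph
    [ffun h : resedge g * bool => tip G ((val h.1).1, h.2)]
    [ffun h : resedge g * bool => leaves G ((val h.1).1, h.2) (+) (val h.1).2].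

Definition resreach (g : E -> nat) (d : bool) : {set V} :=
  reach (residual g) (fun x : resedge g => rescap g (val x)) q d.

(* The trivial walk at [q], which can only be continued by an edge leaving
   [q], counts as a walk entering [q]; hence [q] is never in the flipped set
   [R_leave g :\: R_enter g], and it is in [A_of g] when [g] is maximum. *)
Definition R_enter (g : E -> nat) : {set V} := q |: resreach g false.

Definition R_leave (g : E -> nat) : {set V} := resreach g true.

Definition A_of (g : E -> nat) : {set V} :=
  (R_enter g :\: R_leave g) :|: (R_leave g :\: R_enter g).

Definition M_of (g : E -> nat) : {set V} := ~: (R_enter g :|: R_leave g).

Definition B_of (g : E -> nat) : {set {set V}} :=
  components (residual g) (R_enter g :&: R_leave g).

Definition flipped_graph (g : E -> nat) : bigraph V E :=
  flip G (R_leave g :\: R_enter g).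

(* The [B]'s form a set of sets, so their order is irrelevant. *)
Definition barrier (g : E -> nat) :
    bigraph V E * {set V} * {set V} * {set {set V}} :=
  (flipped_graph g, A_of g, M_of g, B_of g).

End Flows.

(* Main.v *)
Require Import Defs.
From mathcomp Require Import all_boot all_order all_algebra.
From mathcomp Require Import boolp zify ring.

(** Let [g] and [g'] be maximum flows and let [s] be a simple walk of the
    residual graph of [g] from [q] to [v].  Pushing one unit along [s] turns [g]
    into a feasible [f] with one more unit of divergence at [q] and a defect of
    [1] or [-1] at [v].  The difference [f - g'] lives on the residual graph of
    [g'].  A walk that starts at [q] and greedily uses up this difference is
    forced by divergence balance to end at [v] with the same direction as [s],
    or to leave [q] at its end, in which case pushing along it would increase the
    value of [g'].  So the reachable sets of [g] are contained in those of [g'].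
    The components agree because an edge [e] occurs in a residual graph, in one
    orientation at least, exactly when [c e > 0]. *)

Set Implicit Arguments.
Unset Strict Implicit.
Unset Printing Implicit Defensive.

Import Order.TTheory GRing.Theory Num.Theory.

Local Open Scope ring_scope.

Definition dir_sign (b : bool) : int := if b then 1 else -1.

(** The contribution of one unit at the end [h] to the divergence at [w]. *)
Definition end_div (V E : finType) (G : bigraph V E) (h : E * bool) (w : V) : int :=
  if tip G h == w then dir_sign (leaves G h) else 0.

Lemma sum_pair (I J : finType) (F : I * J -> int) :
  \sum_p F p = \sum_i \sum_j F (i, j).
Proof. by rewrite pair_bigA; apply: eq_bigr => -[]. Qed.

(** * Divergence, and walks that use up a function on the edges *)

Section Divergence.

Variables (V E : finType) (G : bigraph V E).

Lemma divergenceE (f : E -> nat) (w : V) :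
  divergence G f w = \sum_h end_div G h w * (f h.1)%:Z.
Proof.
rewrite /divergence big_mkcond [X in _ - X]big_mkcond /= -sumrB; apply: eq_bigr => h _.
rewrite /end_div; case: (tip G h == w); case: (leaves G h) => /=; lia.
Qed.

Lemma eq_divergence (f f' : E -> nat) (w : V) :
  f =1 f' -> divergence G f w = divergence G f' w.
Proof.
by move=> ff'; rewrite !divergenceE; apply: eq_bigr => h _; rewrite ff'.
Qed.

Lemma divergence0 (w : V) : divergence G (fun=> 0%N) w = 0.
Proof. by rewrite divergenceE big1 // => h _; rewrite mulr0. Qed.

Lemma divergence_add_edge (x : E * bool) (z : E -> nat) (w : V) :
  divergence G (fun e => (x.1 == e) + z e)%N w =
  end_div G x w + end_div G (opp_end x) w + divergence G z w.
Proof.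
rewrite !divergenceE.
under eq_bigr do rewrite PoszD mulrDr.
rewrite big_split /=; congr (_ + _).
rewrite (bigD1 x) // (bigD1 (opp_end x)) /=; last first.
  by case: x => e []; rewrite xpair_eqE andbF.
rewrite eqxx !mulr1 big1 ?addr0 // => h /andP[].
case: x h => e b [e' b'] /=; rewrite !xpair_eqE.
by case: (eqVneq e' e) => [->|]; [case: b b' => - [] | rewrite mulr0].
Qed.

(** Where consecutive edges meet, their ends have opposite directions and cancel; only the first and
    the last end of the walk remain. *)
Lemma divergence_path (h : E * bool) (s : seq (E * bool)) (w : V) :
  path (follow G) h s ->
  divergence G (fun e => count (fun k => k.1 == e) (h :: s)) w =
  end_div G h w + end_div G (opp_end (last h s)) w.
Proof.
elim: s h => [|h' s IH] h /=.
  by move=> _; rewrite divergence_add_edge divergence0 addr0.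
move=> /andP[/andP[/eqP tE lE] /IH {}IH].
rewrite (divergence_add_edge h (fun e => count (fun k => k.1 == e) (h' :: s))).
rewrite IH -!addrA; congr (_ + _); rewrite addrA.
suff -> : end_div G (opp_end h) w + end_div G h' w = 0 by rewrite add0r.
rewrite /end_div tE; case: (tip G h' == w) => //.
by case: (leaves G (opp_end h)) (leaves G h') lE => - [].
Qed.

(** If all ends at [u] with a positive amount had direction [b], each term of the divergence times
    [dir_sign b] would be nonnegative. *)
Lemma end_of_divergence (z : E -> nat) (u : V) (b : bool) :
    divergence G z u * dir_sign b < 0 ->
  exists h, [/\ tip G h = u, leaves G h = ~~ b & (0 < z h.1)%N].
Proof.
move=> neg; apply: contrapT => noh; suff: 0 <= divergence G z u * dir_sign b by lia.
rewrite divergenceE mulr_suml; apply: sumr_ge0 => h _; rewrite /end_div.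
case: eqP => tiph; rewrite ?mul0r //.
case: (posnP (z h.1)) => [->|zh]; first by rewrite mulr0 mul0r.
have : leaves G h != ~~ b by apply/eqP => lvh; apply: noh; exists h.
by case: (leaves G h); case: b {neg noh}; rewrite //= /dir_sign; lia.
Qed.

(* [(u, b)] is the state of a walk that has reached [u] leaving it ([b]) or
   entering it ([~~ b]); [T] is the set of states in which the walk may stop, and
   [z] is what is left for the walk to use. *)
Lemma greedy_walk (K : V -> int) (T : V -> bool -> bool)
    (z : E -> nat) (u : V) (b : bool) :
    (forall w, ~~ T w true -> K w < 1) ->
    (forall w, ~~ T w false -> -1 < K w) ->
    (forall w, divergence G z w =
               K w - (if u == w then dir_sign b else 0)) ->
    ~~ T u b ->
  exists h s, [/\ tip G h = u, leaves G h = ~~ b,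
    path (follow G) h s, cap_simple z (h :: s) &
    T (tip G (opp_end (last h s))) (leaves G (opp_end (last h s)))].
Proof.
move=> Kt Kf.
move: {2}(\sum_e z e)%N (erefl (\sum_e z e)%N) => n.
elim: n z u b => [|n IH] z u b zn divz Tub;
  have [|h [tiph lvh zh]] := @end_of_divergence z u b.
(* As the walk may not stop in the state [(u, b)], the bound on [K u] makes the divergence at [u]
   opposite in sign to [dir_sign b]. *)
- by rewrite divz eqxx; case: b Tub {divz} => Tub;
    [have := Kt u Tub | have := Kf u Tub]; rewrite /dir_sign /=; lia.
- by move/eqP: zn; rewrite sum_nat_eq0 => /forallP /(_ h.1) /eqP h0; rewrite h0 in zh.
- by rewrite divz eqxx; case: b Tub {divz} => Tub;
    [have := Kt u Tub | have := Kf u Tub]; rewrite /dir_sign /=; lia.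
pose z' e := (z e - (h.1 == e))%N.
have zE : z =1 (fun e => (h.1 == e) + z' e)%N.
  by move=> e; rewrite /z' subnKC //; case: eqP => [<-|].
(* Crossing [h.1] spends one unit and moves the state to the other end, so the balance equation
   persists with the same [K]. *)
have divz' w : divergence G z' w = K w -
    (if tip G (opp_end h) == w then dir_sign (leaves G (opp_end h)) else 0).
  move: (divz w); rewrite (eq_divergence _ zE) divergence_add_edge.
  rewrite /end_div tiph lvh; case: (u == w); case: (tip G (opp_end h) == w); rewrite /dir_sign;
  by case: b {Tub divz lvh}; case: (leaves G (opp_end h)) => /=; lia.
have z'n : (\sum_e z' e)%N = n.
  move: zn; rewrite (eq_bigr _ (fun e _ => zE e)) big_split /=.
  by rewrite (bigD1 h.1) //= eqxx big1 ?addn0 => [|e /negPf]; [case | rewrite eq_sym => ->].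
have [Th|/(IH _ _ _ z'n divz')[h' [s [t' l' ps cs Ts]]]] :=
  boolP (T (tip G (opp_end h)) (leaves G (opp_end h))).
  exists h, [::]; split=> // e /=.
  by case: eqP => [<-|]; rewrite //= addn0.
exists h, (h' :: s); split=> //=.
  by rewrite ps /follow t' l' eqxx; case: (leaves G (opp_end h)).
by move=> e; rewrite zE /= leq_add2l; apply: cs.
Qed.

End Divergence.

(** * Flow differences and pushing in the residual graph *)

Section Residual.

Variables (V E : finType) (G : bigraph V E) (q : V) (c : E -> nat).

(** By the first hypothesis [y] vanishes on orientations absent from the residual graph, so the sum
    may run over all orientations, reverse edges counting with opposite sign. *)
Lemma divergence_residual (f g : E -> nat) (y : E * bool -> nat) (w : V) :
    (forall x, y x <= rescap c g x)%N ->
    (forall e, f e + y (e, true) = g e + y (e, false))%N ->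
  divergence G f w = divergence G g w +
    divergence (residual G c g) (fun r => y (val r)) w.
Proof.
move=> y_le fE.
have resE : divergence (residual G c g) (fun r => y (val r)) w =
    \sum_(h : E * bool) end_div G h w * ((y (h.1, false))%:Z - (y (h.1, true))%:Z).
  pose S (x : E * bool) :=
    \sum_b end_div G (x.1, b) w * (dir_sign (~~ x.2) * (y x)%:Z).
  transitivity (\sum_(r : resedge c g) S (val r)).
    rewrite divergenceE sum_pair /=.
    apply: eq_bigr => r _; apply: eq_bigr => b _.
    rewrite /end_div /= !ffunE /=; case: (_ == w); rewrite ?mul0r //.
    by case: (leaves G _); case: (val r).2; rewrite /dir_sign /=; lia.
  rewrite -(@big_sub _ _ _ _ [pred x | (0 < rescap c g x)%N] S) big_mkcond /=.
  transitivity (\sum_x S x).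
    apply: eq_bigr => x _; rewrite unfold_in; case: posnP => // x0.
    by rewrite /S big1 // => b _; move: (y_le x); rewrite x0 leqn0 => /eqP ->; rewrite !mulr0.
  rewrite !sum_pair.
  apply: eq_bigr => e _; rewrite !big_bool /S /= !big_bool /dir_sign /=; ring.
rewrite resE !divergenceE -big_split; apply: eq_bigr => -[e b] _ /=.
by rewrite -mulrDr; congr (_ * _); move: (fE e); lia.
Qed.

Lemma push_walk (g : E -> nat) h s :
    feasible c g -> path (follow (residual G c g)) h s ->
    cap_simple (fun x : resedge c g => rescap c g (val x)) (h :: s) ->
  exists2 f, feasible c f & forall w, divergence G f w = divergence G g w +
    (end_div (residual G c g) h w +
     end_div (residual G c g) (opp_end (last h s)) w).
Proof.
move=> g_le ps cs.
pose y x := count (fun k : resedge c g * bool => val k.1 == x) (h :: s).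
have y_le x : (y x <= rescap c g x)%N.
  case: (posnP (y x)) => [-> //|]; rewrite -has_count => /hasP[k _ /eqP <-].
  suff -> : y (val k.1) = count (fun j => j.1 == k.1) (h :: s) by apply: cs.
  by apply: eq_count => j.
have yt e : (y (e, true) <= g e)%N := y_le (e, true).
have yf e : (y (e, false) <= c e - g e)%N := y_le (e, false).
(* By [yt] the subtraction never truncates. *)
exists (fun e => g e + y (e, false) - y (e, true))%N.
  by move=> e; move: (yt e) (yf e) (g_le e); lia.
move=> w; rewrite (divergence_residual (g := g) (y := y)) //.
  by rewrite -divergence_path //; congr (_ + _); apply: eq_divergence.
by move=> e; move: (yt e); lia.
Qed.

(** * Reachable sets of maximum flows *)

Lemma reachP (g : E -> nat) d v :
  reflect (exists h s, [/\ [/\ tip (residual G c g) h = q,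
     tip (residual G c g) (opp_end (last h s)) = v & path (follow (residual G c g)) h s],
     cap_simple (fun x : resedge c g => rescap c g (val x)) (h :: s),
     leaves (residual G c g) h &
     leaves (residual G c g) (opp_end (last h s)) = d])
   (v \in resreach G q c g d).
Proof.
rewrite inE; apply: (iffP (asboolP _)) => -[h [s [W cs lh ls]]]; exists h, s; split=> //.
  by case/and3P: W => /eqP ? ? /eqP ?.
by case: W => tq tv ps; rewrite /= tq tv ps !eqxx.
Qed.

Lemma max_not_R_leave (g : E -> nat) :
  maximum_qflow G q c g -> q \notin R_leave G q c g.
Proof.
move=> [gq gc gmax]; apply/negP => /reachP[h [s [[tq tv ps] cs lh ls]]].
have [f fc fE] := push_walk gc ps cs.
have fq : qflow G q f.
  move=> w wq; rewrite fE gq // /end_div tq tv eq_sym.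
  by rewrite (negPf wq).
(* The walk leaves [q] at both ends, so pushing along it would raise the value by 2. *)
by have := gmax f fq fc; rewrite fE /end_div tq tv lh ls eqxx /dir_sign; lia.
Qed.

Lemma resreach_sub (g g' : E -> nat) d v :
    maximum_qflow G q c g -> maximum_qflow G q c g' -> v != q ->
  v \in resreach G q c g d -> v \in resreach G q c g' d.
Proof.
move=> g_max g'_max vq /reachP[h [s [[tq tv ps] cs lh ls]]].
have valE : divergence G g q = divergence G g' q.
  case: (g_max) (g'_max) => [gq gc gm] [g'q g'c g'm].
  by apply/eqP; rewrite eq_le gm // g'm.
have [gq gc _] := g_max; have [g'q g'c _] := g'_max.
have [f fc fE] := push_walk gc ps cs.
(* The positive part of [f - g'] is put on the edges, the negative part on their reverses. *)
pose y (x : E * bool) := (if x.2 then g' x.1 - f x.1 else f x.1 - g' x.1)%N.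
have y_le x : (y x <= rescap c g' x)%N.
  by rewrite /y /rescap; case: x.2; move: (fc x.1); lia.
have yE e : (f e + y (e, true) = g' e + y (e, false))%N by rewrite /y /=; lia.
pose T w b := ((w == q) && b) || ((w == v) && (b == d)).
pose K w : int := if w == v then dir_sign d else 0.
(* Since [g] and [g'] have equal value, the extra unit of [f] at [q] is exactly the term of the
   starting state, in which [q] counts as entered. *)
have divy w : divergence (residual G c g') (fun r => y (val r)) w =
    K w - (if q == w then dir_sign false else 0).
  move: (fE w); rewrite (divergence_residual w y_le yE) /end_div tq tv lh ls /K.
  rewrite !(eq_sym _ w); case: (eqVneq w q) => [->|wq].
    by rewrite valE eq_sym (negPf vq) /dir_sign; lia.
  by rewrite gq // g'q // /dir_sign; case: (w == v); lia.
have [| | |h' [s' [t' l' ps' cs' Ts']]] := @greedy_walk _ _ _ K T _ _ _ _ _ divy.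
(* [K] is nonzero only at [v], where its sign is that of the direction [d] in which the walk may
   stop. *)
- by move=> w; rewrite /T /K; case: (w == q); case: (w == v) => //; case: d {T K divy ls}.
- by move=> w; rewrite /T /K; case: (w == q); case: (w == v) => //; case: d {T K divy ls}.
- by rewrite /T andbF eq_sym (negPf vq).
have cs2 : cap_simple (fun x : resedge c g' => rescap c g' (val x)) (h' :: s').
  by move=> r; exact: leq_trans (cs' r) (y_le _).
have : forall w b, tip (residual G c g') (opp_end (last h' s')) = w ->
    leaves (residual G c g') (opp_end (last h' s')) = b ->
    w \in resreach G q c g' b.
  by move=> w b tw lb; apply/reachP; exists h', s'; split.
move=> /(_ _ _ erefl erefl).
(* Of the two ways to stop, leaving [q] is excluded by the maximality of [g']. *)
case/orP: Ts' => /andP[/eqP -> ]; last by move/eqP->.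
by move=> ->; rewrite (negPf (max_not_R_leave g'_max)).
Qed.

Lemma R_leave_sub (g g' : E -> nat) :
  maximum_qflow G q c g -> maximum_qflow G q c g' ->
  R_leave G q c g \subset R_leave G q c g'.
Proof.
move=> g_max g'_max; apply/subsetP => v.
have [->|vq] := eqVneq v q; first by rewrite (negPf (max_not_R_leave g_max)).
exact: resreach_sub.
Qed.

Lemma R_enter_sub (g g' : E -> nat) :
  maximum_qflow G q c g -> maximum_qflow G q c g' ->
  R_enter G q c g \subset R_enter G q c g'.
Proof.
move=> g_max g'_max; apply/subsetP => v; rewrite !in_setU1.
by have [//|vq] := eqVneq v q; exact: resreach_sub.
Qed.

(** * Components of the residual graph *)

Lemma adj_in_residual (g : E -> nat) (X : {set V}) u v :
    feasible c g ->
  adj_in (residual G c g) X u v =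
  [&& u \in X, v \in X &
   [exists h : E * bool, [&& tip G h == u, tip G (opp_end h) == v & (0 < c h.1)%N]]].
Proof.
move=> gc; congr [&& _, _ & _]; apply/existsP/existsP => [[[r b]]|[[e b]]].
  rewrite !ffunE /= => /andP[tu tv]; exists ((val r).1, b); rewrite tu tv /=.
  move: (valP r); rewrite /rescap; case: ifP => _ r_gt0; first exact: leq_trans r_gt0 (gc _).
  exact: leq_trans r_gt0 (leq_subr _ _).
move=> /and3P[tu tv /= ce].
(* The reverse edge serves if [g e] is positive; otherwise the edge itself has residual capacity
   [c e]. *)
have re : (0 < rescap c g (e, (0 < g e)%N))%N.
  by rewrite /rescap /=; case: (posnP (g e)) => [->|]; rewrite ?subn0.
by exists (Sub (e, (0 < g e)%N) re : resedge c g, b); rewrite !ffunE tu.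
Qed.

Lemma components_residual (g g' : E -> nat) (X : {set V}) :
    feasible c g -> feasible c g' ->
  components (residual G c g) X = components (residual G c g') X.
Proof.
move=> gc g'c; rewrite /components.
have conE : connect (adj_in (residual G c g) X) =2 connect (adj_in (residual G c g') X).
  by apply: eq_connect => u v; rewrite !adj_in_residual.
by apply: eq_imset => u; apply/setP => v; rewrite !inE conE.
Qed.

End Residual.

Theorem theorem5p4 (V E : finType) (G : bigraph V E) (q : V) (c : E -> nat)
    (q_source : no_entering G q)
    (g g' : E -> nat)
    (g_max : maximum_qflow G q c g) (g'_max : maximum_qflow G q c g') :
  [/\ R_leave G q c g = R_leave G q c g',
      R_enter G q c g = R_enter G q c g',
      barrier G q c g = barrier G q c g'
    & flipped_graph G q c g = flipped_graph G q c g'].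
Proof.
have RlE : R_leave G q c g = R_leave G q c g'.
  by apply/eqP; rewrite eqEsubset !R_leave_sub.
have ReE : R_enter G q c g = R_enter G q c g'.
  by apply/eqP; rewrite eqEsubset !R_enter_sub.
have [_ gc _] := g_max; have [_ g'c _] := g'_max.
have FE : flipped_graph G q c g = flipped_graph G q c g'.
  by rewrite /flipped_graph RlE ReE.
split=> //; rewrite /barrier FE /A_of /M_of /B_of RlE ReE.
by rewrite (components_residual _ _ gc g'c).
Qed.
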